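(* Let $w=a_1a_2\cdots a_kb_1b_2\cdots b_{n-k}\in S_n$ be a $k$-Grassmannian permutation. Then the inversions diagram of shape $w^{-1}$ has shaded boxes only in the intersections of columns $a_1,\dots,a_k$ and rows $b_1,\dots,b_{n-k}$. Moreover, removing the empty rows and columns (those without shaded boxes, and closing up the gaps) and rotating by $180$ degrees gives a bijection $$\mathcal{IT}(w^{-1})\xrightarrow{\ \sim\ }SSYT\bigl(\lambda,(b_1,\dots,b_{n-k})\bigr),\qquad \lambda=(k+i-b_i)_{i=1}^{n-k}.$$
   Context: A permutation $w=w_1\cdots w_n\in S_n$ (one-line notation) is $k$-Grassmannian if it has exactly one descent and this descent is at position $k$, i.e. $w_k>w_{k+1}$; so $a_1<\cdots<a_k$ and $b_1<\cdots<b_{n-k}$. For $v\in S_n$, $\mathrm{Inv}(v)=\{(i,j): i<j,\ v_j<v_i\}$. The staircase consists of the boxes $(i,j)$, $1\le i<j\le n$, with row index $i$ and column index $j$; rows are drawn with index increasing from bottom to top and columns with index increasing from left to right. The inversions diagram of shape $v$ is the staircase with box $(i,j)$ shaded exactly when $(i,j)\in\mathrm{Inv}(v)$. An inversions tableau of shape $v$ assigns a number $T(i,j)\in\{1,\dots,n\}$ to each shaded box, with $T(i,j)=0$ for unshaded boxes, such that: (IT1) for all $i<j$, $T(i,j)$ is the median (counting multiplicities) of the entries of $T$ in the hook $\{(i,j)\}\cup\{(i',j): i<i'<j\}\cup\{(i,j'): i<j'<j\}$; (IT2) no two shaded boxes in the same column have the same entry; (IT3) $T(i,i+1)\le i$ for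 all $1\le i<n$. $\mathcal{IT}(v)$ is the set of inversions tableaux of shape $v$. For a partition $\lambda=(\lambda_1\ge\cdots\ge\lambda_m\ge0)$ and a weakly increasing sequence of positive integers $b=(b_1\le\cdots\le b_m)$, $SSYT(\lambda,b)$ is the set of semistandard Young tableaux of shape $\lambda$ (positive integer entries, weakly increasing along rows left to right, strictly increasing down columns, row 1 at the top) in which every entry of row $i$ is at most $b_i$. *)

(* Defs.v *)
From mathcomp Require Import all_boot all_fingroup matrix.
From mathcomp Require Import boolp classical_sets functions.

Set Implicit Arguments.
Unset Strict Implicit.
Unset Printing Implicit Defensive.

(* Indices in 'I_n are 0-based: i : 'I_n stands for the row, column, position  *)
(* or value i.+1.  One-line notations, positions of descents and tableau       *)
(* entries are 1-based natural numbers.                                        *)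

Definition one_line n (w : 'S_n) : seq nat := [seq (w i).+1 | i <- enum 'I_n].

Definition descents n (w : 'S_n) : seq nat :=
  [seq p <- iota 1 n.-1 | nth 0 (one_line w) p < nth 0 (one_line w) p.-1].

Definition grassmannian n (k : nat) (w : 'S_n) : Prop := descents w = [:: k].

Definition inversions n (v : 'S_n) : {set 'I_n * 'I_n} :=
  [set p : 'I_n * 'I_n | (p.1 < p.2) && (v p.2 < v p.1)].

(* The middle entry of the sorted sequence; only used for odd sizes. *)
Definition median (s : seq nat) : nat := nth 0 (sort leq s) (size s)./2.

Definition hook n (T : 'M[nat]_n) (i j : 'I_n) : seq nat :=
  T i j :: [seq T i' j | i' : 'I_n <- enum 'I_n & i < i' < j]
        ++ [seq T i j' | j' : 'I_n <- enum 'I_n & i < j' < j].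

(* A filling of the staircase is an n x n matrix; the first condition also     *)
(* makes it vanish on and below the diagonal, outside the staircase.           *)
Definition IT n (v : 'S_n) : set 'M[nat]_n :=
  [set T : 'M[nat]_n |
    [/\ forall i j : 'I_n, (i, j) \notin inversions v -> T i j = 0,
        forall i j : 'I_n, (i, j) \in inversions v -> 1 <= T i j <= n,
        forall i j : 'I_n, i < j -> T i j = median (hook T i j),
        forall i i' j : 'I_n, (i, j) \in inversions v -> (i', j) \in inversions v ->
          i != i' -> T i j != T i' j
      & forall i j : 'I_n, j = i.+1 :> nat -> T i j <= i.+1]]%classic.

(* A filling of the Young diagram of lam, with 0-based row i from the top and  *)
(* column j from the left, is extended by 0 outside the diagram; trailing      *)
(* zero parts of lam contribute no box.                                        *)
Definition in_diagram (lam : seq nat) (i j : nat) : bool := j < nth 0 lam i.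

Definition SSYT (lam b : seq nat) : set (nat -> nat -> nat) :=
  [set S : nat -> nat -> nat |
    [/\ forall i j, ~~ in_diagram lam i j -> S i j = 0,
        forall i j, in_diagram lam i j -> 1 <= S i j,
        forall i j j', in_diagram lam i j -> in_diagram lam i j' ->
          j < j' -> S i j <= S i j',
        forall i i' j, in_diagram lam i j -> in_diagram lam i' j ->
          i < i' -> S i j < S i' j
      & forall i j, in_diagram lam i j -> S i j <= nth 0 b i]]%classic.

Definition nonempty_rows n (v : 'S_n) : seq 'I_n :=
  [seq i <- enum 'I_n | [exists j, (i, j) \in inversions v]].

Definition nonempty_cols n (v : 'S_n) : seq 'I_n :=
  [seq j <- enum 'I_n | [exists i, (i, j) \in inversions v]].

(* Arrays list their rows from top to bottom, whereas the rows of an           *)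
(* inversions diagram are drawn with index increasing from bottom to top.      *)
Definition compressed n (v : 'S_n) (T : 'M[nat]_n) : seq (seq nat) :=
  [seq [seq T i j | j <- nonempty_cols v] | i <- rev (nonempty_rows v)].

Definition rotate180 (A : seq (seq nat)) : seq (seq nat) := rev (map rev A).

Definition array_entry (A : seq (seq nat)) (i j : nat) : nat :=
  nth 0 (nth [::] A i) j.

Definition compress_rotate n (v : 'S_n) (T : 'M[nat]_n) : nat -> nat -> nat :=
  array_entry (rotate180 (compressed v T)).

(* The parts k + i - b_i for i = 1, ..., size b.  When b is the second block   *)
(* of a k-Grassmannian permutation, b_i - i of the k values of the first       *)
(* block are below b_i, so the subtraction does not truncate.                  *)
Definition grassmannian_shape (k : nat) (b : seq nat) : seq nat :=
  [seq k + i - nth 0 b i.-1 | i <- iota 1 (size b)].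

(* Main.v *)
Require Import Defs.
From mathcomp Require Import all_boot all_order all_fingroup matrix.
From mathcomp Require Import boolp classical_sets functions zify.

(** The inversions of w^-1 are the pairs i < j of values such that j stands
before i in w.  Each block of w is increasing, so i lies in the second block and
j in the first: with B the set of values of the second block, the shaded boxes
are exactly the boxes of the staircase in a row of B and a column outside B.

The heart of the proof is [ITP], which reads the axioms of an inversions tableau
on such a shape.  The hook of a box (i, j) consists of the box and of two boxes
for each x strictly between i and j, namely (x, j) and (i, x).  When (i, j) is
shaded, exactly one of these two is shaded, since x is in B or not; hence zeros
are exactly one short of a majority, and the median is the least nonzero entry.
When (i, j) is not shaded, zeros have the majority and the median condition is
automatic.  So (IT1) says that, in a shaded box, T i j is at most the other
nonzero entries of its hook.  With
(IT2), entries increase strictly with the row index along a column and decrease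
weakly with the column index along a row; the rotation by 180 degrees turns this
into semistandardness.  Under these monotonicity conditions (IT3) is equivalent
to the bound by i of all entries of row i: in the leftmost shaded box of row i,
either the column is i + 1 and (IT3) applies, or row i + 1 is in B too and the
bound of row i + 1 together with strictness in the column gives that of row i.

It remains to identify the shapes.  Among the values below the r-th element x of
B, r - 1 are in B, so the columns of index above x number k - (x - 1 - (r - 1)),
which is the r-th part of lambda ([in_diagramE]).  The nonempty rows form an
initial segment of B and the nonempty columns a final segment of its complement,
so after compression and rotation the box (r, c) still comes from the r-th
element of B and the c-th largest element of the complement
([compress_rotateE]).  The bijection [IT_SSYT_bij] is then a change of
coordinates. *)

Set Implicit Arguments.
Unset Strict Implicit.
Unset Printing Implicit Defensive.

Import Order.POrderTheory Order.TotalTheory.DualTotalTheory.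

(** * Medians of sequences of natural numbers *)

Lemma medianE (s : seq nat) x : 0 < size s ->
  (median s == x) =
  (count (fun y => y < x) s <= (size s)./2 < count (fun y => y <= x) s).
Proof.
move=> s_gt0; rewrite /median.
have h : (size s)./2 < size (sort leq s) by rewrite size_sort; lia.
have st : sorted Order.le (sort leq s) by exact: sort_sorted leq_total s.
rewrite -!(seq.permP (permEl (perm_sort leq s))).
apply/eqP/idP => [<-|]; last exact: (nth_count_eq 0 st).
apply/andP; split; rewrite leqNgt; apply/negP => lt_i.
  by have := nth_count_lt 0 st lt_i; rewrite ltxx.
have := nth_count_gt 0 st (x := nth 0 (sort leq s) (size s)./2) (i := (size s)./2).
by rewrite ltxx h andbT => /(_ lt_i).
Qed.

(** This settles the unshaded boxes. *)
Lemma median_eq0 (s : seq nat) :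
  (size s)./2 < count (pred1 0) s -> median s = 0.
Proof.
move=> h; apply/eqP; rewrite medianE; last by case: s h.
rewrite (@eq_count _ _ pred0) // count_pred0 (@eq_count _ _ (pred1 0)) // => y.
by rewrite /= leqn0.
Qed.

(** If one more zero would be needed for a majority, the zeros occupy all places
before the middle of the sorted sequence, so the middle holds the least nonzero
entry: the case of shaded boxes. *)
Lemma median_half0 (s : seq nat) x : 0 < x -> x \in s ->
  count (pred1 0) s = (size s)./2 ->
  (median s == x) = all (fun y => (y == 0) || (x <= y)) s.
Proof.
move=> x0 xs h; rewrite medianE; last by case: s xs {h}.
have -> : count (fun y => y < x) s =
    count (pred1 0) s + count (fun y => ~~ ((y == 0) || (x <= y))) s.
  elim: s {xs h} => //= y s ->; lia.
have -> : count (fun y => y <= x) s =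
    count (pred1 0) s + count (fun y => ~~ ((y == 0) || (x <= y))) s +
    count (pred1 x) s.
  elim: s {xs h} => //= y s ->; lia.
have : 0 < count (pred1 x) s by rewrite -has_count has_pred1.
rewrite all_count.
rewrite -[X in _ = (_ == X)](count_predC (fun y => (y == 0) || (x <= y)) s).
by rewrite /predC /= h; set c := count (fun y => ~~ _) s; lia.
Qed.

(** * Initial segments of sorted sequences *)

(** A predicate that is closed downwards along a sorted sequence selects an
initial segment of it, so filtering does not move the entries that it keeps. *)
Lemma nth_map_filter_sorted (T : eqType) (R : Type) (r : rel T) (P : pred T)
    (f : T -> R) (s : seq T) (x0 : T) (y0 : R) c :
  transitive r -> sorted r s -> {in s &, forall x y, r x y -> P y -> P x} ->
  nth y0 [seq f x | x <- s & P x] c =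
  if (c < size s) && P (nth x0 s c) then f (nth x0 s c) else y0.
Proof.
move=> tr; elim: s c => [|x s IH] c sx rP; first by rewrite /= nth_nil.
have xs := order_path_min tr sx.
have {IH} IH := IH _ (path_sorted sx)
  (sub_in2 (mem_behead (s := x :: s)) rP).
rewrite [filter P _]/=; case: ifP => [Px | nPx].
  by case: c => [|c]; rewrite /= ?Px ?IH.
rewrite (_ : filter P s = [::]) /=.
  rewrite nth_nil; case: c => [|c] /=; first by rewrite nPx.
  rewrite ltnS; case: ifP => // /andP[cs Pc].
  have ys := mem_nth x0 cs.
  by rewrite (rP x _ _ _ (allP xs _ ys) Pc) ?inE ?eqxx ?ys ?orbT in nPx.
apply/eqP; rewrite -size_eq0 size_filter eqn0Ngt -has_count -all_predC.
apply/allP => y ys /=; apply/negP => /(rP x _ _ _ (allP xs _ ys)).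
by rewrite nPx !inE eqxx ys orbT => /(_ isT isT).
Qed.

(** * Inversions tableaux on a shape with rows B and columns outside B *)

Section TwoBlocks.

Variables (n : nat) (v : 'S_n) (B : {set 'I_n}).
Hypothesis invE : forall i j : 'I_n,
  ((i, j) \in inversions v) = [&& i < j, i \in B & j \notin B].

Lemma size_hook (T : 'M[nat]_n) (i j : 'I_n) :
  (size (hook T i j))./2 = size [seq x : 'I_n <- enum 'I_n | i < x < j].
Proof. by rewrite /hook /= size_cat !size_map; lia. Qed.

Lemma zeros_hook (T : 'M[nat]_n) (i j : 'I_n)
    (p := [pred x : 'I_n | i < x < j]) :
  count (pred1 0) (hook T i j) = (T i j == 0) +
    (count (fun x => T x j == 0) (filter p (enum 'I_n)) +
     count (fun x => T i x == 0) (filter p (enum 'I_n))).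
Proof. by rewrite /hook /= count_cat !count_map. Qed.

(** For x between i and j, exactly one of T x j and T i x vanishes: the former if
x is outside B, the latter if x is in B.  So there are as many zeros as boxes in
one arm of the hook. *)
Lemma hook_median_inv (T : 'M[nat]_n) :
  (forall i j, (i, j) \notin inversions v -> T i j = 0) ->
  (forall i j, (i, j) \in inversions v -> 0 < T i j) ->
  forall i j, (i, j) \in inversions v ->
  (T i j == median (hook T i j)) =
  all (fun y => (y == 0) || (T i j <= y)) (hook T i j).
Proof.
move=> T0 T1 i j ij; rewrite eq_sym median_half0 ?T1 ?mem_head //.
rewrite zeros_hook size_hook -(count_predC (mem B)).
have /negPf -> : T i j != 0 by rewrite -lt0n T1.
rewrite add0n addnC; congr (_ + _); apply: eq_in_count => x;
  rewrite mem_filter => /andP[/= /andP[ix xj] _]; move: ij;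
  rewrite invE => /and3P[lij iB jB]; case: (boolP (x \in B)) => xB.
- by apply/eqP/T0; rewrite invE xB !andbF.
- by apply/negbTE; rewrite -lt0n T1 // invE ix iB xB.
- by apply/negbTE; rewrite -lt0n T1 // invE xj xB jB.
- by apply/eqP/T0; rewrite invE (negPf xB) !andbF.
Qed.

(** One arm of the hook vanishes entirely, the row if i is outside B and the
column if j is in B; with the box itself this makes a majority of zeros. *)
Lemma hook_median_notin (T : 'M[nat]_n) :
  (forall i j, (i, j) \notin inversions v -> T i j = 0) ->
  forall i j : 'I_n, i < j -> (i, j) \notin inversions v ->
  median (hook T i j) = 0.
Proof.
move=> T0 i j lij nij; apply: median_eq0.
rewrite zeros_hook size_hook T0 // eqxx; move: nij; rewrite invE lij /=.
set L := filter _ _; rewrite negb_and => /orP[iB | jB].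
  rewrite (_ : count (fun x => T i x == 0) L = size L); first lia.
  apply/eqP; rewrite -all_count; apply/allP => x _.
  by rewrite T0 // invE (negPf iB) andbF.
rewrite (_ : count (fun x => T x j == 0) L = size L); first lia.
apply/eqP; rewrite -all_count; apply/allP => x _.
by rewrite T0 // invE (negPf jB) !andbF.
Qed.

(** The median condition is local to each hook; here it becomes monotonicity
along rows and columns, the language of semistandard tableaux before rotation.
The flag condition on the boxes next to the diagonal spreads to whole rows. *)
Lemma ITP (T : 'M[nat]_n) : IT v T <->
  [/\ forall i j, (i, j) \notin inversions v -> T i j = 0,
      forall i j, (i, j) \in inversions v -> 0 < T i j,
      forall i j j' : 'I_n, (i, j) \in inversions v ->
        (i, j') \in inversions v -> j < j' -> T i j' <= T i j,
      forall i i' j : 'I_n, (i, j) \in inversions v ->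
        (i', j) \in inversions v -> i < i' -> T i j < T i' j
    & forall i j, (i, j) \in inversions v -> T i j <= i.+1].
Proof.
split=> [[T0 Tn med dis bd] | [T0 T1 row col bd]].
- have T1 i j : (i, j) \in inversions v -> 0 < T i j by case/Tn/andP.
  have min i j : (i, j) \in inversions v ->
      all (fun y => (y == 0) || (T i j <= y)) (hook T i j).
    move=> ij; rewrite -hook_median_inv //; apply/eqP/med.
    by move: ij; rewrite invE => /and3P[].
  have row i j j' : (i, j) \in inversions v -> (i, j') \in inversions v ->
      j < j' -> T i j' <= T i j.
    move=> ij ij' jj'.
    have /allP/(_ (T i j)) := min _ _ ij'; rewrite eqn0Ngt T1 //; apply.
    rewrite /hook inE mem_cat map_f ?orbT // mem_filter mem_enum jj' !andbT.
    by move: ij; rewrite invE => /and3P[].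
  have col (i i' j : 'I_n) : (i, j) \in inversions v ->
      (i', j) \in inversions v -> i < i' -> T i j < T i' j.
    move=> ij i'j ii'; rewrite ltn_neqAle dis //=; last by rewrite neq_ltn ii'.
    have /allP/(_ (T i' j)) := min _ _ ij; rewrite [_ == 0]eqn0Ngt T1 //; apply.
    rewrite /hook inE mem_cat (map_f (fun x => T x j)) ?orbT //.
    rewrite mem_filter mem_enum ii' andbT.
    by move: i'j; rewrite invE => /and3P[].
  (* Row i is bounded by its neighbour in the box (i, i + 1) when i + 1 is a
     column, and by row i + 1 minus one when i + 1 is a row. *)
  split=> // i j; have [m] := ubnP (j - i); elim: m i => // m IH i hm ij.
  have /and3P[lij iB jB] : [&& i < j, i \in B & j \notin B] by rewrite -invE.
  have [e|ne] := eqVneq (j : nat) i.+1; first exact: bd.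
  have hx : i.+1 < n by have := ltn_ord j; lia.
  pose x := Ordinal hx; case: (boolP (x \in B)) => xB.
  + have xj : (x, j) \in inversions v by rewrite invE xB jB /= !andbT; lia.
    have := IH x _ xj; have := col i x j ij xj (ltnSn _); rewrite /=; lia.
  + have ix : (i, x) \in inversions v by rewrite invE iB xB /= !andbT.
    apply: leq_trans (bd i x erefl); apply: row => //=; lia.
- split=> //.
  + by move=> i j ij; rewrite T1 //= (leq_trans (bd _ _ ij)).
  + move=> i j lij.
    have [ij | nij] := boolP ((i, j) \in inversions v); last first.
      by rewrite hook_median_notin // T0.
    apply/eqP; rewrite hook_median_inv //; apply/allP => y.
    rewrite /hook inE mem_cat => /or3P[/eqP -> | /mapP[x + ->] | /mapP[x + ->]];
      first by rewrite leqnn orbT.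
      rewrite mem_filter => /andP[/andP[ix xj] _].
      have [xi | /T0 -> //] := boolP ((x, j) \in inversions v).
      by rewrite ltnW ?orbT ?col.
    rewrite mem_filter => /andP[/andP[ix xj] _].
    have [xi | /T0 -> //] := boolP ((i, x) \in inversions v).
    by rewrite row ?orbT.
  + move=> i i' j ij i'j; rewrite -val_eqE !neq_ltn.
    by case/orP=> /col -> //; rewrite ?orbT.
  + move=> i j e; have [/bd // | /T0 -> //] := boolP ((i, j) \in inversions v).
Qed.

(** * Coordinates after compression and rotation *)

Lemma enum_setE (A : {set 'I_n}) : enum A = [seq i <- enum 'I_n | i \in A].
Proof. by rewrite enumT. Qed.

Lemma sorted_enum (A : {set 'I_n}) : sorted (fun x y : 'I_n => x < y) (enum A).
Proof.
rewrite enum_setE; apply: sorted_filter => [y x z /=|]; first exact: ltn_trans.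
by have := iota_ltn_sorted 0 n; rewrite -val_enum_ord sorted_map.
Qed.

Variable i0 : 'I_n.

(** Row r of the rotated array comes from the r-th smallest element of B, and
column c from the c-th largest element of the complement: reading from the
right reverses the columns, while the two reversals of the rows, from the
drawing convention and from the rotation, cancel. *)
Definition row_at r := nth i0 (enum B) r.
Definition col_at c := nth i0 (rev (enum (~: B))) c.
Definition box r c :=
  [&& r < #|B|, c < #|~: B| & (row_at r, col_at c) \in inversions v].

Lemma row_at_in r : r < #|B| -> row_at r \in B.
Proof. by move=> h; rewrite -mem_enum mem_nth // -cardE. Qed.

Lemma col_at_notin c : c < #|~: B| -> col_at c \notin B.
Proof.
move=> h; rewrite -finset.in_setC -mem_enum -mem_rev.
by rewrite mem_nth // size_rev -cardE.
Qed.

Lemma boxE r c :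
  box r c = [&& r < #|B|, c < #|~: B| & row_at r < col_at c].
Proof.
rewrite /box invE; case: ltnP => //= /row_at_in ->.
by case: ltnP => //= /col_at_notin ->; rewrite andbT.
Qed.

Lemma row_at_lt r r' : r' < #|B| -> r < r' -> row_at r < row_at r'.
Proof.
move=> h' lt; apply: (sorted_ltn_nth _ i0 (sorted_enum B)) => //.
- by move=> y x z /=; apply: ltn_trans.
- by rewrite inE -cardE (ltn_trans lt).
- by rewrite inE -cardE.
Qed.

Lemma sorted_rev_enum (A : {set 'I_n}) :
  sorted (fun x y : 'I_n => y < x) (rev (enum A)).
Proof. by rewrite rev_sorted sorted_enum. Qed.

Lemma col_at_lt c c' : c' < #|~: B| -> c < c' -> col_at c' < col_at c.
Proof.
move=> h' lt; apply: (sorted_ltn_nth _ i0 (sorted_rev_enum (~: B))) => //.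
- by move=> y x z /= xy yz; apply: ltn_trans yz xy.
- by rewrite inE size_rev -cardE (ltn_trans lt).
- by rewrite inE size_rev -cardE.
Qed.

Definition row_pos (i : 'I_n) := index i (enum B).
Definition col_pos (j : 'I_n) := index j (rev (enum (~: B))).

Lemma row_atK r : r < #|B| -> row_pos (row_at r) = r.
Proof. by move=> h; rewrite /row_pos index_uniq ?enum_uniq // -cardE. Qed.

Lemma col_atK c : c < #|~: B| -> col_pos (col_at c) = c.
Proof.
by move=> h; rewrite /col_pos index_uniq ?rev_uniq ?enum_uniq // size_rev -cardE.
Qed.

Lemma box_pos i j : (i, j) \in inversions v ->
  [/\ box (row_pos i) (col_pos j), row_at (row_pos i) = i
    & col_at (col_pos j) = j].
Proof.
move=> ij; have := ij; rewrite invE => /and3P[lij iB jB].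
have ei : row_at (row_pos i) = i by rewrite /row_at nth_index // mem_enum.
have ej : col_at (col_pos j) = j.
  by rewrite /col_at nth_index // mem_rev mem_enum finset.in_setC.
rewrite /box ei ej ij !cardE -(size_rev (enum (~: B))) !index_mem.
by rewrite mem_rev !mem_enum finset.in_setC iB jB.
Qed.

(** A row of B left of some column has every smaller row of B left of it as well,
so the rows deleted by the compression are the last ones; likewise for the
columns in decreasing order.  Hence no surviving box changes coordinates. *)
Lemma compress_rotateE (T : 'M[nat]_n) r c :
  (forall i j, (i, j) \notin inversions v -> T i j = 0) ->
  compress_rotate v T r c = if box r c then T (row_at r) (col_at c) else 0.
Proof.
move=> T0.
pose rowP i := [exists j, (i, j) \in inversions v].
pose colP j := [exists i, (i, j) \in inversions v].
have rowsE : nonempty_rows v = [seq i <- enum B | rowP i].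
  rewrite enum_setE -filter_predI; apply: eq_filter => i /=.
  rewrite andb_idr // => /existsP[j]; by rewrite invE => /and3P[].
have colsE : rev (nonempty_cols v) = [seq j <- rev (enum (~: B)) | colP j].
  rewrite filter_rev enum_setE -filter_predI; congr rev; apply: eq_filter => j /=.
  rewrite andb_idr // finset.in_setC => /existsP[i]; by rewrite invE => /and3P[].
rewrite /compress_rotate /rotate180 /compressed /array_entry -map_comp.
rewrite map_rev revK.
rewrite (eq_map (g := fun i => [seq T i j | j <- rev (nonempty_cols v)])); last first.
  by move=> i /=; rewrite map_rev.
rewrite rowsE colsE.
have rowsP := nth_map_filter_sorted (P := rowP)
  (fun i => [seq T i j | j <- rev (enum (~: B)) & colP j]) i0 [::] r
  _ (sorted_enum B) _.
rewrite rowsP; last 2 first.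
- by move=> y x z /=; apply: ltn_trans.
- move=> x y; rewrite !mem_enum => xB yB xy /existsP[j].
  rewrite invE => /and3P[yj _ jB]; apply/existsP; exists j.
  by rewrite invE xB jB (ltn_trans xy yj).
have colsP i := nth_map_filter_sorted (P := colP) (T i) i0 0 c
  _ (sorted_rev_enum (~: B)) _.
rewrite (fun_if (fun s => nth 0 s c)) nth_nil colsP; last 2 first.
- by move=> y x z /= xy yz; apply: ltn_trans yz xy.
- move=> x y; rewrite !mem_rev !mem_enum !finset.in_setC.
  move=> xB yB xy /existsP[i].
  rewrite invE => /and3P[iy iB _]; apply/existsP; exists i.
  by rewrite invE xB iB (ltn_trans iy xy).
rewrite size_rev -!cardE /box -/(row_at r) -/(col_at c).
case: (r < _) => //=; case: (c < _) => /=; last by rewrite if_same.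
case: (boolP (_ \in inversions v)) => [ij | /T0 ->]; last by rewrite !if_same.
rewrite /rowP /colP !(introT existsP) //.
  by exists (row_at r).
by exists (col_at c).
Qed.

Lemma count_lt_ord x : x <= n ->
  count (fun y => y < x) (map val (enum B)) +
  count (fun y => y < x) (map val (enum (~: B))) = x.
Proof.
move=> xn; rewrite -count_cat -map_cat.
have /(perm_map val)/seq.permP -> : perm_eq (enum B ++ enum (~: B)) (enum 'I_n).
  rewrite !enum_setE [X in _ ++ X](@eq_filter _ _ (predC (mem B))).
    by rewrite (permEl (perm_filterC (mem B) (enum 'I_n))).
  by move=> i; rewrite finset.in_setC.
by rewrite val_enum_ord -size_filter (filter_iota_ltn 0) // size_iota.
Qed.

(** Column c lies right of row r when more than c elements of the complement
exceed x = row_at r.  By [count_lt_ord], x - r elements of the complement are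
below x, since r elements of B are. *)
Lemma in_diagramE r c :
  in_diagram (grassmannian_shape #|~: B| [seq (val i).+1 | i <- enum B]) r c =
  box r c.
Proof.
rewrite boxE /in_diagram /grassmannian_shape size_map -cardE.
have [rB | Br] := ltnP r #|B|; last first.
  by rewrite nth_default ?ltn0 // size_map size_iota.
rewrite (nth_map 0) ?size_iota // nth_iota // add1n /= (nth_map i0) -?cardE //.
rewrite -/(row_at r); set x := row_at r.
have sB (A : {set 'I_n}) : sorted Order.lt (map val (enum A)).
  by rewrite sorted_map; exact: sorted_enum.
have cB : count (fun y => y < x) (map val (enum B)) = r.
  have := @count_lt_nth _ _ 0 _ r (sB B).
  by rewrite size_map -cardE (nth_map i0) -?cardE //; apply.
have := count_lt_ord (ltnW (ltn_ord x)); rewrite cB => cx.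
have rx : r <= x by rewrite -cx leq_addr.
have {}cx : count (fun y => y < x) (map val (enum (~: B))) = x - r.
  by rewrite -[in RHS]cx addKn.
have [cA | Ac] /= := ltnP c #|~: B|; last first.
  by apply/negbTE; rewrite -leqNgt leq_subLR addnC; apply: leq_add.
(* The place of col_at c in the increasing enumeration of the complement. *)
pose p := #|~: B| - c.+1.
have pA : p < #|~: B| by rewrite /p ltn_subrL (leq_ltn_trans _ cA).
have cE : col_at c = nth i0 (enum (~: B)) p by rewrite /col_at nth_rev -cardE.
have cE' : nth 0 (map val (enum (~: B))) p = col_at c :> nat.
  by rewrite (nth_map i0) -?cardE // -cE.
have xc : x != col_at c :> nat.
  apply/eqP => /val_inj xc; have := col_at_notin cA; by rewrite -xc row_at_in.
have sA := sub_sorted (@ltW _ _) (sB (~: B)).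
case: (leqP (count (fun y => y < x) (map val (enum (~: B)))) p) => h.
  have := nth_count_ge 0 sA (x := val x) (i := p).
  rewrite h size_map -cardE pA cE'.
  move/(_ isT); rewrite leEnat => xle; rewrite (ltn_neqAle x) xc xle /=.
  by move: h; rewrite cx /p; move: cA; set m := #|_|; lia.
have := nth_count_lt 0 sA h; rewrite cE' ltEnat /= => lt.
rewrite [RHS]ltnNge (ltnW lt) /=; apply/negbTE; rewrite -leqNgt.
by move: h; rewrite cx /p; move: cA; set m := #|_|; lia.
Qed.

Lemma IT_SSYT_bij :
  set_bij (IT v)
    (SSYT (grassmannian_shape #|~: B| [seq (val i).+1 | i <- enum B])
          [seq (val i).+1 | i <- enum B])
    (compress_rotate v).
Proof.
have bE r c : box r c ->
    nth 0 [seq (val i).+1 | i <- enum B] r = (row_at r).+1.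
  by rewrite boxE => /and3P[rB _ _]; rewrite (nth_map i0) // -cardE.
split.
- move=> T /ITP[T0 T1 row col bd].
  split=> [i j | i j | i j j' | i i' j | i j];
    rewrite !in_diagramE !compress_rotateE //.
  + by move/negPf->.
  + by move=> /[dup] ij ->; apply: T1; case/and3P: ij.
  + move=> /[dup] ij -> /[dup] ij' -> lt; case/and3P: ij => _ _ ij.
    by case/and3P: ij' => _ cj' ij'; apply: row => //; apply: col_at_lt.
  + move=> /[dup] ij -> /[dup] i'j -> lt; case/and3P: ij => _ _ ij.
    by case/and3P: i'j => ri' _ i'j; apply: col => //; apply: row_at_lt.
  + by move=> /[dup] ij ->; rewrite (bE _ _ ij); apply: bd; case/and3P: ij.
- move=> T T'; rewrite !inE => /ITP[T0 _ _ _ _] /ITP[T0' _ _ _ _] eT.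
  apply/matrixP => i j.
  have [ij | nij] := boolP ((i, j) \in inversions v); last first.
    by rewrite T0 // T0'.
  have [bij ei ej] := box_pos ij.
  have := congr1 (fun S => S (row_pos i) (col_pos j)) eT.
  by rewrite /= !compress_rotateE // bij ei ej.
- move=> S [S0 S1 row col bd].
  pose T : 'M[nat]_n := (\matrix_(i, j)
    if (i, j) \in inversions v then S (row_pos i) (col_pos j) else 0%N)%R.
  have TE i j : (i, j) \in inversions v -> T i j = S (row_pos i) (col_pos j).
    by move=> ij; rewrite mxE ij.
  have T0 i j : (i, j) \notin inversions v -> T i j = 0.
    by move=> /negPf ij; rewrite mxE ij.
  exists T; last first.
    apply/funext => r; apply/funext => c; rewrite compress_rotateE //.
    case: ifPn => [rc | rc]; last by rewrite S0 // in_diagramE.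
    by case/and3P: rc => rB cA ij; rewrite TE // row_atK ?col_atK.
  apply/ITP; split=> // [i j ij | i j j' ij ij' lt | i i' j ij i'j lt | i j ij].
  + by have [b _ _] := box_pos ij; rewrite TE // S1 // in_diagramE.
  + have [b ei ej] := box_pos ij; have [b' _ ej'] := box_pos ij'.
    rewrite !TE // row ?in_diagramE // ltnNge leq_eqVlt; apply/norP; split.
      by apply/eqP => e; move: lt; rewrite -ej -ej' e ltnn.
    apply/negP => lt'; have cA : col_pos j' < #|~: B| by case/and3P: b'.
    by have := col_at_lt cA lt'; rewrite ej ej' ltnNge ltnW.
  + have [b ei ej] := box_pos ij; have [b' ei' _] := box_pos i'j.
    rewrite !TE // col ?in_diagramE // ltnNge leq_eqVlt; apply/norP; split.
      by apply/eqP => e; move: lt; rewrite -ei -ei' e ltnn.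
    apply/negP => lt'; have rB : row_pos i < #|B| by case/and3P: b.
    by have := row_at_lt rB lt'; rewrite ei ei' ltnNge ltnW.
  + have [b ei _] := box_pos ij; rewrite TE // -{2}ei.
    by rewrite -(bE _ _ b) bd // in_diagramE.
Qed.

End TwoBlocks.

(** * The two blocks of a Grassmannian permutation *)

Section Grassmannian.

Variables (n : nat) (w : 'S_n) (a b : seq nat).
Hypothesis hw : grassmannian (size a) w.
Hypothesis hab : one_line w = a ++ b.

Lemma size_one_line : size (one_line w) = n.
Proof. by rewrite size_map size_enum_ord. Qed.

Lemma nth_one_line (p : 'I_n) : nth 0 (one_line w) p = (w p).+1.
Proof. by rewrite (nth_map p) ?size_enum_ord // nth_ord_enum. Qed.

Lemma uniq_one_line : uniq (one_line w).
Proof. by rewrite map_inj_uniq ?enum_uniq // => p q [/val_inj/perm_inj]. Qed.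

Lemma one_line_step p : p.+1 < n -> p.+1 != size a ->
  nth 0 (one_line w) p < nth 0 (one_line w) p.+1.
Proof.
move=> pn pa; have : p.+1 \notin descents w by rewrite hw inE.
rewrite mem_filter mem_iota /= (_ : p.+1 < 1 + n.-1) ?andbT; last by lia.
rewrite -leqNgt leq_eqVlt nth_uniq ?size_one_line ?uniq_one_line ?(ltnW pn) //.
by rewrite ltn_eqF.
Qed.

Lemma block_sorted : sorted ltn a /\ sorted ltn b.
Proof.
have := size_one_line; rewrite hab size_cat => sz.
have nth_a p : p < size a -> nth 0 a p = nth 0 (one_line w) p.
  by move=> h; rewrite hab nth_cat h.
have nth_b p : nth 0 b p = nth 0 (one_line w) (size a + p).
  by rewrite hab nth_cat ltnNge leq_addr /= addKn.
split; apply/(sortedP 0) => p hp.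
  by rewrite !nth_a ?(ltnW hp) //; apply: one_line_step; lia.
by rewrite !nth_b addnS; apply: one_line_step; lia.
Qed.

Lemma mem_block (p : 'I_n) : ((w p).+1 \in b) = (size a <= p).
Proof.
have := uniq_one_line; rewrite hab cat_uniq => /and3P[_ /hasPn ab _].
have := size_one_line; rewrite -nth_one_line hab size_cat nth_cat => sz.
case: ltnP => h; last by rewrite mem_nth // ltn_subLR // sz.
by apply/negP => /ab /=; rewrite mem_nth.
Qed.

Lemma block_increasing (p q : 'I_n) :
  (size a <= p) = (size a <= q) -> p < q -> w p < w q.
Proof.
have [sa sb] := block_sorted => pq lt.
rewrite -ltnS -!nth_one_line hab !nth_cat !ltnNge -pq.
have := size_one_line; rewrite hab size_cat => sz; have := ltn_ord q => qn.
case: leqP pq => /= hp /esym hq; rewrite -ltnNge.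
  by apply: (sorted_ltn_nth ltn_trans 0 sb); rewrite ?inE; lia.
by apply: (sorted_ltn_nth ltn_trans 0 sa); rewrite ?inE; lia.
Qed.

Definition second_block : {set 'I_n} := [set i : 'I_n | i.+1 \in b]%SET.

(** For values i < j at positions p and q, q < p forces p and q into different
blocks because each block is increasing; then q is in the first one. *)
Lemma inversions_invE (i j : 'I_n) : ((i, j) \in inversions w^-1%g) =
  [&& i < j, i \in second_block & j \notin second_block].
Proof.
rewrite !finset.inE /=; case: (ltnP i j) => //= ij.
rewrite -{2}(permKV w i) -{2}(permKV w j) !mem_block.
set p := (w^-1)%g i; set q := (w^-1)%g j.
have wij : w p < w q by rewrite !permKV.
case: (leqP (size a) p) => hp; case: (leqP (size a) q) => hq /=; try by lia.
- by apply/negbTE/negP => /block_increasing; rewrite hp hq => /(_ erefl); lia.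
- apply/negbTE/negP => /block_increasing; rewrite !(leqNgt (size a)) hp hq.
  by move/(_ erefl); lia.
Qed.

Lemma second_blockE : b = [seq (val i).+1 | i <- enum second_block].
Proof.
have [_ sb] := block_sorted.
apply: (irr_sorted_eq ltn_trans ltnn sb).
  by rewrite sorted_map; exact: sorted_enum.
move=> x; apply/idP/mapP => [xb | [i + ->]]; last by rewrite mem_enum finset.inE.
have : x \in one_line w by rewrite hab mem_cat xb orbT.
case/mapP => p _ e; exists (w p) => //.
by rewrite mem_enum finset.inE -e.
Qed.

Lemma card_first_block : #|~: second_block| = size a.
Proof.
have szb : size b = #|second_block|.
  by have /(congr1 size) := second_blockE; rewrite size_map -cardE.
apply: (@addnI #|second_block|).
by rewrite cardsC card_ord -szb addnC -size_cat -hab size_one_line.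
Qed.

End Grassmannian.

Theorem proposition5p4 (n k : nat) (w : 'S_n) (a b : seq nat)
    (hw : grassmannian k w) (hab : one_line w = a ++ b) (ha : size a = k) :
  (forall i j : 'I_n, (i, j) \in inversions w^-1%g -> i.+1 \in b /\ j.+1 \in a) /\
  set_bij (IT w^-1%g) (SSYT (grassmannian_shape k b) b)
    (compress_rotate w^-1%g).
Proof.
subst k; have invE := inversions_invE hw hab; split.
  move=> i j; rewrite invE !finset.inE => /and3P[_ ib jb]; split=> //.
  have : j.+1 \in one_line w.
    by apply/mapP; exists ((w^-1)%g j); rewrite ?mem_enum ?permKV.
  by rewrite hab mem_cat (negPf jb) orbF.
have n_gt0 : 0 < n by case: n w hw {hab invE} => [|//] w; rewrite /grassmannian.
have := IT_SSYT_bij invE (Ordinal n_gt0).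
by rewrite (card_first_block hw hab) -(second_blockE hw hab).
Qed.
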